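(* Let $p$ be a prime, $n\ge 1$ an integer and $q=p^n$. Suppose a permutation $f$ of $\mathbb{F}_q$ has Carlitz rank $r>0$. Then its additive index satisfies $$\mathrm{AddInd}(f)\ \ge\ \min\left\{\frac{q}{r},\frac{q-2r}{2}\right\}.$$ Further, if $r=1$ and $q>4$, then $\mathrm{AddInd}(f)=q$.
   Context: Carlitz rank: by a theorem of Carlitz, for $q\ge 3$ the group of permutations of $\mathbb{F}_q$ under composition is generated by the inversion map ($0\mapsto 0$, $x\mapsto x^{-1}$ for $x\ne 0$; i.e. $x\mapsto x^{q-2}$) and all affine maps $x\mapsto \alpha x+\beta$ with $\alpha,\beta\in\mathbb{F}_q$, $\alpha\neq 0$. The Carlitz rank $\mathrm{Crk}(f)$ of a permutation $f$ of $\mathbb{F}_q$ is the minimum number of inversions needed to write $f$ as a composition of inversions and such affine maps. In particular $\mathrm{Crk}(f)=0$ if and only if $f(x)=ax+b$ for some $a\neq 0$, $b\in\mathbb{F}_q$. (For $q=2$ every permutation is affine, of Carlitz rank $0$.) Additive index: view $\mathbb{F}_q$ as an $n$-dimensional vector space over $\mathbb{F}_p$. A map $f:\mathbb{F}_q\to\mathbb{F}_q$ is of codimension at most $k$ ($0\le k\le n$) if there are an $\mathbb{F}_p$-linear map $M:\mathbb{F}_q\to\mathbb{F}_q$ (equivalently, a map induced by a linearised polynomial $\sum_j a_jX^{p^j}$, $a_j\in\mathbb{F}_q$) and an $\mathbb{F}_p$-subspace $U$ of $\mathbb{F}_q$ of dimension $n-k$ such that $f-M$ is constant on each coset of $U$.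 The codimension $\mathrm{codim}\, f$ is the smallest such $k$, and $\mathrm{AddInd}(f)=p^{\mathrm{codim}\, f}$. *)

(* Defs.v *)
From HB Require Import structures.
From mathcomp Require Import all_boot all_order all_algebra all_fingroup all_field.
From mathcomp Require Import boolp.

Set Implicit Arguments.
Unset Strict Implicit.
Unset Printing Implicit Defensive.

Import GRing.Theory.
Local Open Scope ring_scope.

Section CarlitzRank.
Variable F : finFieldType.

Inductive carlitz_gen : Type :=
  | Affine (a b : F) of a != 0
  | Inversion.

(* In a MathComp field 0^-1 = 0, so [x^-1] is the inversion map at 0 as well. *)
Definition carlitz_eval (s : carlitz_gen) (x : F) : F :=
  match s with
  | Affine a b _ => a * x + b
  | Inversion => x^-1
  end.

Definition is_inversion (s : carlitz_gen) : bool :=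
  if s is Inversion then true else false.

(* The last element of the word is applied first. *)
Definition word_eval (w : seq carlitz_gen) (x : F) : F :=
  foldr carlitz_eval x w.

Definition written_with (f : {perm F}) (m : nat) : Prop :=
  exists w : seq carlitz_gen, f =1 word_eval w /\ count is_inversion w = m.

Lemma word_eval_cat (w1 w2 : seq carlitz_gen) (x : F) :
  word_eval (w1 ++ w2) x = word_eval w1 (word_eval w2 x).
Proof. by rewrite /word_eval foldr_cat. Qed.

(* The transposition (0 c) is
     x |-> - c^2 * (((x - c)^-1 + c^-1)^-1 - c)^-1,
   and (a b) is its conjugate by x |-> x - a for c = b - a. *)
Lemma tperm_word (a b : F) : a != b ->
  exists w : seq carlitz_gen, tperm a b =1 word_eval w.
Proof.
move=> neq_ab; set c := b - a.
have c0 : c != 0 by rewrite subr_eq0 eq_sym.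
have d0 : - c ^+ 2 != 0 by rewrite oppr_eq0 expf_neq0.
have n1 : 1 != 0 :> F by exact: oner_neq0.
exists [:: Affine a d0; Inversion; Affine (- c) n1; Inversion;
           Affine c^-1 n1; Inversion; Affine (- b) n1].
move=> x; rewrite /word_eval /= !mul1r.
case: tpermP => [->|->|].
- have -> : a - b = - c by rewrite /c opprB.
  rewrite invrN addNr invr0 add0r invrN mulrNN expr2 mulfK //.
  by rewrite /c subrK.
- by rewrite subrr invr0 add0r invrK subrr invr0 mulr0 add0r.
- move=> /eqP xa /eqP xb.
  have y0 : x - a != 0 by rewrite subr_eq0.
  have z0 : x - b != 0 by rewrite subr_eq0.
  have Ez : x - b = (x - a) - c by rewrite /c opprB addrA subrK.
  have E1 : (x - b)^-1 + c^-1 = (x - a) / (c * (x - b)).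
    apply: (mulIf (mulf_neq0 c0 z0)); rewrite divfK ?mulf_neq0 //.
    rewrite mulrDl mulKf // [c * _]mulrC mulKf // Ez.
    by rewrite addrC subrK.
  have E2 : ((x - b)^-1 + c^-1)^-1 - c = - c ^+ 2 / (x - a).
    rewrite E1 invf_div; apply: (mulIf y0).
    by rewrite mulrBl !divfK // -mulrBr Ez addrAC subrr add0r mulrN expr2.
  by rewrite E2 invf_div mulrC divfK // subrK.
Qed.

(* Carlitz's theorem: the generators do generate the symmetric group. *)
Lemma written_with_exists (f : {perm F}) : exists m, `[< written_with f m >].
Proof.
suff [w Hw] : exists w, f =1 word_eval w.
  by exists (count is_inversion w); apply/asboolP; exists w.
have [ts -> dts] := prod_tpermP f.
elim: ts dts => [|[a b] ts IH] /=.
  by move=> _; exists [::] => x; rewrite big_nil perm1.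
move=> /andP[dab /IH[w Hw]].
have [w' Hw'] := tperm_word dab.
by exists (w ++ w') => x; rewrite big_cons permM word_eval_cat -Hw -Hw'.
Qed.

Definition Crk (f : {perm F}) : nat := ex_minn (written_with_exists f).

End CarlitzRank.

Section AdditiveIndex.
Variables (p : nat) (F : finFieldType) (charF : p \in [pchar F]).

(* [pPrimeCharType charF] is the carrier F with its 'F_p-vector space
   structure. *)
Let V : vectType 'F_p := pPrimeCharType charF.

Definition codim_at_most (f : F -> F) (k : nat) : Prop :=
  (k <= \dim {:V})%N /\
  exists (M : 'End(V)) (U : {vspace V}),
    \dim U = (\dim {:V} - k)%N /\
    forall x y : V, x - y \in U -> (f x : V) - M x = (f y : V) - M y.

Lemma codim_at_most_exists (f : F -> F) : exists k, `[< codim_at_most f k >].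
Proof.
exists (\dim {:V}); apply/asboolP; split => //.
exists 0, 0%VS; split; first by rewrite dimv0 subnn.
by move=> x y; rewrite memv0 subr_eq0 => /eqP ->.
Qed.

Definition codim (f : F -> F) : nat := ex_minn (codim_at_most_exists f).

Definition AddInd (f : F -> F) : nat := (p ^ codim f)%N.

End AdditiveIndex.

(* Main.v *)
Require Import Defs.
From mathcomp Require Import all_boot all_order all_algebra all_fingroup all_field.
From mathcomp Require Import boolp zify ring.

Set Implicit Arguments.
Unset Strict Implicit.
Unset Printing Implicit Defensive.

(* A word with [m] inversions agrees with a fractional linear map off a set
   [P] of at most [m] points (each inversion creates at most one new pole). If
   f - M is constant on the cosets of a subspace U, then f (x + u) - f x = M u
   for u in U. If the fractional linear map is not affine and u != 0, this is
   a nonzero quadratic equation in x, valid whenever x and x + u avoid P, so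
   q - 2r <= 2. If it is an affine map a x + b and q > 2r, some x has x and
   x + u both off P, so M u = a u on U; if moreover |U| > r, every coset of U
   contains a point off P and f is affine everywhere, so r = 0. Hence
   |U| <= r or q <= 2r + 2, where AddInd f = q / |U| for the best U. *)

Import GRing.Theory Num.Theory.
Local Open Scope ring_scope.

Lemma word_eval_mobius (F : finFieldType) (w : seq (carlitz_gen F)) :
  exists (a b c d : F) (P : {set F}),
    [/\ a * d - b * c != 0, (#|P| <= count (@is_inversion F) w)%N &
      forall x, x \notin P ->
        c * x + d != 0 /\ word_eval w x = (a * x + b) / (c * x + d)].
Proof.
elim: w => [|s w [a [b [c [d [P [det0 leP offP]]]]]]].
  exists 1, 0, 0, 1, set0; split; rewrite ?cards0 //.
    by rewrite mulr1 mul0r subr0 oner_neq0.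
  by move=> x _; rewrite mul0r add0r oner_neq0 mul1r addr0 divr1.
case: s => [al be al0|] /=.
  exists (al * a + be * c), (al * b + be * d), c, d, P; split => //.
    have -> : (al * a + be * c) * d - (al * b + be * d) * c
              = al * (a * d - b * c) by ring.
    by rewrite mulf_neq0.
  move=> x /offP[den0 ->]; split => //.
  by field.
(* Inversion swaps numerator and denominator, so the new exceptional point is the zero of
   [a * x + b]. If [a = 0], then [b] is nonzero and no pole arises; the added point is then 0, which
   is harmless. *)
exists c, d, a, b, ((- b / a) |: P); split.
- have -> : c * b - d * a = - (a * d - b * c) by ring.
  by rewrite oppr_eq0.
- by rewrite cardsU1; apply: leq_add => //; case: (_ \notin _).
move=> x; rewrite !inE negb_or => /andP[xNb /offP[den0 ->]].
rewrite invf_div; split => //; apply: contraNneq xNb => ax_b.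
have a0 : a != 0.
  apply: contraNneq det0 => a0; rewrite a0 mul0r add0r in ax_b.
  by rewrite a0 ax_b !mul0r subrr.
by rewrite -(addr0_eq ax_b) opprK mulrC mulKf.
Qed.

(** The points left out form the union of [P] and its translate by [- u]. *)
Lemma card_both_notin (F : finFieldType) (P : {set F}) (u : F) :
  (#|F| <= #|[set x | (x \notin P) && (x + u \notin P)%R]| + 2 * #|P|)%N.
Proof.
have -> : [set x | (x \notin P) && (x + u \notin P)]
          = ~: (P :|: [set y - u | y in P]).
  apply/setP => x; rewrite !inE negb_or; congr (_ && ~~ _).
  apply/idP/imsetP => [xuP|[y yP ->]]; last by rewrite subrK.
  by exists (x + u) => //; rewrite addrK.
have imP : (#|[set (y - u)%R | y in P]| <= #|P|)%N by exact: leq_imset_card.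
rewrite -(cardsC (P :|: [set y - u | y in P])) addnC leq_add2l.
have [leU _] := leq_card_setU P [set y - u | y in P].
by apply: leq_trans leU _; rewrite mul2n -addnn leq_add2l.
Qed.

Lemma mobius_shift_card (F : finFieldType) (g : F -> F) (P : {set F})
    (a b c d u m : F) :
  a * d - b * c != 0 -> c != 0 -> u != 0 ->
  (forall x, x \notin P ->
     c * x + d != 0 /\ g x = (a * x + b) / (c * x + d)) ->
  (forall x, g (x + u) - g x = m) ->
  (#|F| <= 2 * #|P| + 2)%N.
Proof.
move=> det0 c0 u0 offP gm.
(* This is [g (x + u) - g x = m] with denominators cleared: the numerator of the difference
   collapses to [u * (a * d - b * c)]. *)
pose p := Poly [:: m * d * (c * u + d) - u * (a * d - b * c);
                   m * c * (c * u + d + d); m * c ^+ 2].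
have pE x : p.[x] = m * (c * x + d) * (c * (x + u) + d) - u * (a * d - b * c).
  by rewrite horner_Poly /=; ring.
have p0 : p != 0.
  (* At the pole only the constant [- u * (a * d - b * c)] survives, so [p] is nonzero even when
     [m = 0]. *)
  apply/negP => /eqP p0; have := pE (- d / c).
  have -> : c * (- d / c) + d = 0 by field.
  rewrite p0 horner0 mulr0 mul0r sub0r => /esym/eqP.
  by rewrite oppr_eq0 mulf_eq0 (negPf u0) (negPf det0).
pose S := [set x | (x \notin P) && (x + u \notin P)].
have leS : (#|S| < 3)%N.
  apply: (leq_trans _ (size_Poly _ : size p <= 3)%N).
  rewrite cardE; apply: max_poly_roots p0 _ (enum_uniq _).
  apply/allP => x; rewrite mem_enum inE => /andP[/offP[d1 g1] /offP[d2 g2]].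
  rewrite rootE pE -(gm x) g1 g2; apply/eqP.
  by field; rewrite d1 d2.
have := card_both_notin P u; rewrite -/S; lia.
Qed.

Lemma affine_shift_extend (F : finFieldType) (g M : F -> F) (P U : {set F})
    (a b : F) :
  (2 * #|P| < #|F|)%N -> (#|P| < #|U|)%N ->
  (forall x, x \notin P -> g x = a * x + b) ->
  (forall x u, u \in U -> g (x + u) - g x = M u) ->
  forall x, g x = a * x + b.
Proof.
move=> ltPF ltPU offP gM x.
have ME u : u \in U -> M u = a * u.
  move=> uU.
  have /card_gt0P[y] : (0 < #|[set x | (x \notin P) && (x + u \notin P)%R]|)%N.
    by have := card_both_notin P u; lia.
  rewrite inE => /andP[/offP gy /offP gyu].
  by rewrite -(gM y) // gy gyu; ring.
(* The translate of [U] by [x] is larger than [P], so it has a point off [P]; shifting back from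
   there by the known [M u] gives [g x]. *)
have /subsetPn[_ /imsetP[u uU ->] xuP] : ~~ ([set x + u | u in U] \subset P).
  apply: contraL ltPU => /subset_leq_card.
  by rewrite card_imset -?leqNgt //; apply: addrI.
have := gM x u uU; rewrite ME // offP // => /eqP; rewrite subr_eq => /eqP e.
apply: (addrI (a * u)); rewrite -e.
by ring.
Qed.

(** This trades the subspace for a plain finite set, so that the rest is counting in [F]. *)
Lemma AddInd_witness (p : nat) (F : finFieldType) (charF : p \in [pchar F])
    (f : F -> F) :
  exists (U : {set F}) (M : F -> F), (#|U| * AddInd charF f = #|F|)%N /\
    forall x u, u \in U -> f (x + u) - f x = M u.
Proof.
rewrite /AddInd /codim; case: ex_minnP => k /asboolP[lek [M [U [dU fM]]]] _.
have cardV (W : {vspace pPrimeCharType charF}) :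
    #|[set x : F | x \in W]| = (p ^ \dim W)%N.
  by rewrite cardsE (@card_vspace _ F _ W) card_Fp ?(pcharf_prime charF).
exists [set x : F | x \in U], M; split.
  rewrite cardV dU -expnD subnK // -cardV -cardsT.
  by apply: eq_card => x; rewrite !inE; apply: memvf.
move=> x u; rewrite inE => uU.
have := fM (x + u) x; rewrite [x + u]addrC addrK => /(_ uU).
rewrite linearD /= => /eqP; rewrite subr_eq => /eqP ->.
(* The goal mixes the operations of the vector space with those of [F]; they are convertible, and
   [ring] works in [F]. *)
have ring_id (y m l : F) : y - l + (m + l) - y = m by ring.
exact: ring_id.
Qed.

Lemma Crk_affine (F : finFieldType) (f : {perm F}) (a b : F) :
  a != 0 -> (forall x, f x = a * x + b) -> Crk f = 0%N.
Proof.
move=> a0 fE; rewrite /Crk; case: ex_minnP => m _ /(_ 0%N).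
rewrite leqn0 => m0; apply/eqP/m0/asboolP.
by exists [:: Affine b a0].
Qed.

Lemma card_shift_le_Crk (F : finFieldType) (f : {perm F}) (M : F -> F)
    (U : {set F}) :
  (0 < Crk f)%N -> (forall x u, u \in U -> f (x + u) - f x = M u) ->
  (#|U| <= Crk f)%N || (#|F| <= 2 * Crk f + 2)%N.
Proof.
move=> r0 fM; case: leqP => //= ltrU.
have [w [fw rw]] : written_with f (Crk f).
  by rewrite /Crk; case: ex_minnP => m /asboolP.
have [a [b [c [d [P [det0 leP offP]]]]]] := word_eval_mobius w.
rewrite rw in leP.
have foffP x : x \notin P ->
  c * x + d != 0 /\ f x = (a * x + b) / (c * x + d) by rewrite fw; apply: offP.
have [c0|c0] := eqVneq c 0; last first.
  (* Otherwise [U] lies in [{0}] and has at most [1 <= Crk f] elements. *)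
  have /existsP[u /andP[uU u0]] : [exists u, (u \in U) && (u != 0)].
    apply: contraLR ltrU => /existsPn U0.
    rewrite -leqNgt (leq_trans _ r0) // -(cards1 (0 : F)).
    apply/subset_leq_card/subsetP => u uU.
    by have := U0 u; rewrite uU inE negbK.
  have fMu x := fM x u uU.
  apply: leq_trans (mobius_shift_card det0 c0 u0 foffP fMu) _.
  by rewrite leq_add2r leq_mul2l.
rewrite leqNgt; apply/negP => ltrF; move: r0.
have /andP[a0 d0] : (a != 0) && (d != 0).
  by move: det0; rewrite c0 mulr0 subr0 mulf_eq0 negb_or.
rewrite (@Crk_affine _ f (a / d) (b / d)) ?mulf_neq0 ?invr_eq0 //.
apply: (@affine_shift_extend _ _ _ P) fM.
- apply: leq_ltn_trans ltrF; rewrite (leq_trans _ (leq_addr _ _)) //.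
  by rewrite leq_mul2l.
- exact: leq_ltn_trans leP ltrU.
- by move=> x /foffP[_ ->]; rewrite c0 mul0r add0r; field.
Qed.

Theorem theorem2 (p n : nat) (hp : prime p) (hn : (1 <= n)%N)
    (F : finFieldType) (hq : #|F| = (p ^ n)%N)
    (f : {perm F}) (r : nat) (hr : Crk f = r) (hr0 : (0 < r)%N) :
  let q := (p ^ n)%N in
  let addInd := AddInd (card_finPcharP hq hp) f in
  (Num.min (q%:R / r%:R) ((q%:R - 2 * r%:R) / 2) <= addInd%:R :> rat)
  /\ (r = 1%N -> (4 < q)%N -> addInd = q).
Proof.
move=> q A.
have [U [M [cardU fM]]] := AddInd_witness (card_finPcharP hq hp) f.
rewrite -/A hq -/q in cardU.
have q0 : (0 < q)%N by rewrite expn_gt0 prime_gt0.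
have A0 : (0 < A)%N by rewrite expn_gt0 prime_gt0.
have := @card_shift_le_Crk _ f M U; rewrite hr hq -/q => /(_ hr0 fM) bound.
split; last first.
  (* For [r = 1] the second alternative reads [q <= 4], so only [#|U| <= 1] remains. *)
  move=> r1 q4; move: bound; rewrite r1 [(q <= _)%N]leqNgt q4 orbF => U1.
  have : (0 < #|U|)%N by move: q0; rewrite -cardU muln_gt0 => /andP[].
  by rewrite -cardU => U0; rewrite (@anti_leq #|U| 1) ?U1 // mul1n.
(* If [#|U| <= r], then [q = #|U| * A <= r * A]; if [q <= 2 * r + 2], the second term is at most
   [1 <= A]. *)
rewrite Order.TotalTheory.ge_min; case/orP: bound => bound; apply/orP; [left|right].
  rewrite ler_pdivrMr ?ltr0n // -natrM ler_nat -cardU [leqRHS]mulnC.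
  by rewrite leq_mul2r bound orbT.
rewrite ler_pdivrMr ?ltr0n // lerBlDr -!natrM -natrD ler_nat; lia.
Qed.
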